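(* Let $F,\ell_1,\dots,\ell_m:\mathbb{R}^n\to\mathbb{R}$ be continuously differentiable with $F^*:=\inf_{\theta}F(\theta)>-\infty$, $\inf_\theta\ell_i(\theta)>-\infty$ for all $i$, and $\sup_\theta\|\nabla F(\theta)\|\le c$. Let $e>0$, let $\alpha_t\ge0$ for all $t\in\mathbb{R}_+$ with $\sup_{t\ge0}\alpha_t<\infty$, let $\epsilon>e$, and assume $g_\epsilon:=\sup\{g(\theta):\theta\in\overline{\mathcal{P}}_\epsilon\}<+\infty$. Let $\{\theta_t:t\in\mathbb{R}_+\}$ be a solution of the Pareto navigation flow $d\theta_t=-v_t\,dt$ (see context) with $\theta_0\in\mathcal{P}_\epsilon$. Then for all $t>0$, $$\inf_{s\in[0,t]}\Big\|\frac{d\theta_s}{ds}\Big\|^2\le\frac{F(\theta_0)-F^*}{t}+\frac1t\int_0^t\alpha_s\big(\alpha_sg_\epsilon+c\sqrt{g_\epsilon}\big)\,ds,$$ where the infimum is over those $s\in[0,t]$ at which the derivative exists. In particular: (a) If $\alpha_t=\alpha$ is constant in $t$, then $\inf_{s\in[0,t]}\|d\theta_s/ds\|^2=O\big(1/t+\alpha\sqrt{g_\epsilon}\big)$. (b) If $\int_0^\infty\alpha_t^\gamma\,dt<+\infty$ for some $\gamma\ge1$, then $\inf_{s\in[0,t]}\|d\theta_s/ds\|^2=O\big(1/t+\sqrt{g_\epsilon}/t^{1/\gamma}\big)$. Here $O(\cdot)$ means bounded by a constant, independent of $t>0$, times the given expression.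
   Context: $\|\cdot\|$ is the Euclidean norm, $\mathbb{R}_+=[0,\infty)$, $\mathcal{C}^m=\{\omega\in\mathbb{R}_+^m:\sum_i\omega_i=1\}$, and $\vec\ell=(\ell_1,\dots,\ell_m)$. Define $$g(\theta)=\min_{\omega\in\mathcal{C}^m}\Big\|\sum_{i=1}^m\omega_i\nabla\ell_i(\theta)\Big\|^2,\qquad \mathcal{P}_\epsilon=\{\theta\in\mathbb{R}^n:g(\theta)\le\epsilon\}.$$ Write $\vec\ell(\theta')\preceq\vec\ell(\theta)$ if $\ell_i(\theta')\le\ell_i(\theta)$ for all $i$. The Pareto closure of a point is $\overline{\{\theta\}}=\{\theta'\in\mathbb{R}^n:\vec\ell(\theta')\preceq\vec\ell(\theta)\}$, and $\overline{\mathcal{P}}_\epsilon=\bigcup_{\theta\in\mathcal{P}_\epsilon}\overline{\{\theta\}}$. Pareto navigation flow: $t\mapsto\alpha_t$ is measurable. The velocity $v_t$ at $\theta_t$ is $$v_t=\arg\min_{v\in\mathbb{R}^n}\tfrac12\|\nabla F(\theta_t)-v\|^2\ \text{ s.t. }\ \nabla\ell_i(\theta_t)^\top v\ge\phi_t\ \forall i,\qquad \phi_t=\begin{cases}-\infty& g(\theta_t)\le e,\\ \alpha_tg(\theta_t)& g(\theta_t)>e,\end{cases}$$ so $v_t=\nabla F(\theta_t)$ when $g(\theta_t)\le e$. Since $v_t$ is discontinuous across the boundary of $\mathcal{P}_e$, solutions of $d\theta_t=-v_t\,dt$ are taken in the Filippov (differential inclusion) sense: $t\mapsto\theta_t$ is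 locally absolutely continuous on $\mathbb{R}_+$ and for almost every $t$, $\frac{d\theta_t}{dt}=-v_t$ if $\theta_t\notin\mathcal{P}_e$; $\frac{d\theta_t}{dt}=-\nabla F(\theta_t)$ if $\theta_t$ is in the interior of $\mathcal{P}_e$; and if $\theta_t$ is on the boundary of $\mathcal{P}_e$, $\frac{d\theta_t}{dt}=-(\beta w_t+(1-\beta)\nabla F(\theta_t))$ for some $\beta\in[0,1]$ (possibly depending on $t$), where $w_t$ is the minimizer of the same quadratic program with $\phi_t$ replaced by $\alpha_tg(\theta_t)$. *)

(* Defs.v *)
(* MathComp-Analysis; R : realType, R^n is 'rV[R]_n. *)
From mathcomp Require Import all_boot all_order all_algebra.
From mathcomp Require Import all_classical all_reals all_analysis.

Set Implicit Arguments.
Unset Strict Implicit.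
Unset Printing Implicit Defensive.

Import Order.TTheory GRing.Theory Num.Theory.
Import numFieldNormedType.Exports.

Local Open Scope classical_set_scope.
Local Open Scope ring_scope.

Definition dot (R : realType) (n : nat) (u v : 'rV[R]_n) : R :=
  \sum_(i < n) u 0 i * v 0 i.

(* The library norm on 'rV[R]_n is the sup norm, which induces the same
   topology but is not the norm needed here. *)
Definition enorm (R : realType) (n : nat) (v : 'rV[R]_n) : R :=
  Num.sqrt (dot v v).

Definition grad (R : realType) (n : nat) (f : 'rV[R]_n -> R)
    (x : 'rV[R]_n) : 'rV[R]_n :=
  \row_(i < n) 'D_(delta_mx 0 i) f x.

Definition C1 (R : realType) (n : nat) (f : 'rV[R]_n -> R) : Prop :=
  (forall x, differentiable f x) /\ continuous (grad f).

Definition simplex (R : realType) (m : nat) : set 'rV[R]_m :=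
  [set w | (forall i, 0 <= w 0 i) /\ \sum_(i < m) w 0 i = 1].

(* For m > 0 the simplex is compact and nonempty, so that this infimum is a
   minimum as soon as it is taken of a continuous function of w, as here. *)
Definition pareto_gap (R : realType) (m n : nat)
    (ell : 'I_m -> 'rV[R]_n -> R) (x : 'rV[R]_n) : R :=
  inf [set enorm (\sum_(i < m) w 0 i *: grad (ell i) x) ^+ 2
      | w in @simplex R m].

Definition pareto_set (R : realType) (m n : nat)
    (ell : 'I_m -> 'rV[R]_n -> R) (eps : R) : set 'rV[R]_n :=
  [set x | pareto_gap ell x <= eps].

Definition pareto_closure (R : realType) (m n : nat)
    (ell : 'I_m -> 'rV[R]_n -> R) (x : 'rV[R]_n) : set 'rV[R]_n :=
  [set y | forall i, ell i y <= ell i x].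

Definition pareto_set_closure (R : realType) (m n : nat)
    (ell : 'I_m -> 'rV[R]_n -> R) (eps : R) : set 'rV[R]_n :=
  \bigcup_(x in pareto_set ell eps) pareto_closure ell x.

Definition boundary (T : topologicalType) (A : set T) : set T :=
  closure A `\` interior A.

Definition qp_feasible (R : realType) (m n : nat)
    (ell : 'I_m -> 'rV[R]_n -> R) (x : 'rV[R]_n) (phi : \bar R)
    (v : 'rV[R]_n) : Prop :=
  forall i, (phi <= (dot (grad (ell i) x) v)%:E)%E.

Definition qp_argmin (R : realType) (m n : nat)
    (F : 'rV[R]_n -> R) (ell : 'I_m -> 'rV[R]_n -> R) (x : 'rV[R]_n)
    (phi : \bar R) (v : 'rV[R]_n) : Prop :=
  qp_feasible ell x phi v /\
  forall v', qp_feasible ell x phi v' ->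
    2^-1 * enorm (grad F x - v) ^+ 2 <= 2^-1 * enorm (grad F x - v') ^+ 2.

Definition nav_phi (R : realType) (m n : nat)
    (ell : 'I_m -> 'rV[R]_n -> R) (e a : R) (x : 'rV[R]_n) : \bar R :=
  if pareto_gap ell x <= e then -oo%E else (a * pareto_gap ell x)%:E.

(* Derivative relative to [0, +oo[: two-sided at s > 0 and one-sided at
   s = 0, so that values of theta at negative times are irrelevant. *)
Definition is_derive_nneg (R : realType) (n : nat) (theta : R -> 'rV[R]_n)
    (s : R) (d : 'rV[R]_n) : Prop :=
  h^-1 *: (theta (s + h) - theta s)
    @[h --> within [set h | 0 <= s + h] 0^'] --> d.

Definition abs_continuous (R : realType) (n : nat) (a b : R)
    (theta : R -> 'rV[R]_n) : Prop :=
  forall eps : R, 0 < eps -> exists2 delta : R, 0 < delta &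
  forall (N : nat) (p q : 'I_N -> R),
    (forall i, a <= p i /\ p i <= q i /\ q i <= b) ->
    (forall i j, i != j -> q i <= p j \/ q j <= p i) ->
    \sum_(i < N) (q i - p i) < delta ->
    \sum_(i < N) enorm (theta (q i) - theta (p i)) < eps.

Definition filippov_velocity (R : realType) (m n : nat)
    (F : 'rV[R]_n -> R) (ell : 'I_m -> 'rV[R]_n -> R) (e a : R)
    (x d : 'rV[R]_n) : Prop :=
  [/\ ~ pareto_set ell e x ->
        exists2 v, qp_argmin F ell x (nav_phi ell e a x) v & d = - v,
      interior (pareto_set ell e) x -> d = - grad F x
    & boundary (pareto_set ell e) x ->
        exists beta : R, exists w : 'rV[R]_n,
          [/\ 0 <= beta <= 1,
              qp_argmin F ell x (a * pareto_gap ell x)%:E w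
            & d = - (beta *: w + (1 - beta) *: grad F x)]].

Definition pareto_navigation_flow (R : realType) (m n : nat)
    (F : 'rV[R]_n -> R) (ell : 'I_m -> 'rV[R]_n -> R) (e : R)
    (alpha : R -> R) (theta : R -> 'rV[R]_n) : Prop :=
  (forall a b : R, 0 <= a -> a <= b -> abs_continuous a b theta) /\
  {ae @lebesgue_measure R, forall t : R, 0 <= t ->
     exists2 d, is_derive_nneg theta t d
       & filippov_velocity F ell e (alpha t) (theta t) d}.

Definition inf_sq_speed (R : realType) (n : nat) (theta : R -> 'rV[R]_n)
    (t : R) : \bar R :=
  ereal_inf [set z | exists s d,
    [/\ 0 <= s <= t, is_derive_nneg theta s d & z = (enorm d ^+ 2)%:E]].

(* Main.v *)
(* In the feasible polyhedron [<grad ell_i, v> >= a g] of the quadratic program,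
   consider [a u], where [u] is the point of least norm of the convex hull of
   the gradients: it is feasible since [<grad ell_i, u> >= |u|^2 = g].
   Comparing it with the optimal velocity [v], the projection of [grad F], gives
   [<grad F, v> >= |v|^2 - a (a g + c sqrt g)], and this survives the convex
   combinations with [grad F] allowed on the boundary. Integrating along the
   flow, [t * inf |theta'|^2 <= F(theta_0) - F^* + \int a (a g + c sqrt g)],
   and [g <= g_eps] since the flow never leaves the Pareto closure of the level
   set [eps]: where [g > e] all the [ell_i] decrease, and where [g <= e] the
   point itself is in the level set.
   Integration rests on the fact that an absolutely continuous function with an
   almost everywhere nonpositive derivative is nonincreasing. For (b), the
   integral of [alpha] is bounded by [x <= l + l^(1 - gamma) x^gamma] with
   [l = t^(-1/gamma)]. *)
Require Import Defs.
From mathcomp Require Import all_boot all_order all_algebra.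
From mathcomp Require Import all_classical all_reals all_analysis.
From mathcomp Require Import measurable_realfun.
From mathcomp Require Import ring lra.

Import Order.TTheory GRing.Theory Num.Theory.
Import numFieldNormedType.Exports.

Local Open Scope classical_set_scope.
Local Open Scope ring_scope.

(** * The Euclidean norm *)

Section euclidean.
Context {R : realType} {n : nat}.
Implicit Types (u v w : 'rV[R]_n) (a : R).

Lemma dotC u v : dot u v = dot v u.
Proof. by apply: eq_bigr => i _; rewrite mulrC. Qed.

Lemma dotDl u v w : dot (u + v) w = dot u w + dot v w.
Proof. by rewrite /dot -big_split; apply: eq_bigr => i _; rewrite mxE mulrDl. Qed.

Lemma dotZl a u v : dot (a *: u) v = a * dot u v.
Proof. by rewrite /dot mulr_sumr; apply: eq_bigr => i _; rewrite mxE mulrA. Qed.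

Lemma dotNl u v : dot (- u) v = - dot u v.
Proof. by rewrite -scaleN1r dotZl mulN1r. Qed.

Lemma dotDr u v w : dot w (u + v) = dot w u + dot w v.
Proof. by rewrite dotC dotDl !(dotC w). Qed.

Lemma dotZr a u v : dot v (a *: u) = a * dot v u.
Proof. by rewrite dotC dotZl dotC. Qed.

Lemma dotNr u v : dot v (- u) = - dot v u.
Proof. by rewrite dotC dotNl dotC. Qed.

Definition dotE := (dotDl, dotDr, dotZl, dotZr, dotNl, dotNr).

Lemma dot_ge0 u : 0 <= dot u u.
Proof. by apply: sumr_ge0 => i _; rewrite -expr2 sqr_ge0. Qed.

Lemma enorm_ge0 u : 0 <= enorm u.
Proof. exact: sqrtr_ge0. Qed.

Lemma sqr_enorm u : enorm u ^+ 2 = dot u u.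
Proof. by rewrite sqr_sqrtr // dot_ge0. Qed.

Lemma enormN u : enorm (- u) = enorm u.
Proof. by rewrite /enorm dotNl dotNr opprK. Qed.

Lemma enormZ a u : enorm (a *: u) = `|a| * enorm u.
Proof.
by rewrite /enorm dotZl dotZr mulrA -expr2 sqrtrM ?sqr_ge0 // sqrtr_sqr.
Qed.

Lemma coord_le_enorm u i : `|u 0 i| <= enorm u.
Proof.
rewrite -sqrtr_sqr ler_sqrt ?dot_ge0 // /dot (bigD1 i) //= -expr2 lerDl.
by apply: sumr_ge0 => j _; rewrite -expr2 sqr_ge0.
Qed.

Lemma norm_le_enorm u : `|u| <= enorm u.
Proof.
rewrite /Num.norm /= mx_normrE; apply: bigmax_le; first exact: enorm_ge0.
by move=> [i j] _ /=; rewrite ord1 coord_le_enorm.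
Qed.

Lemma coord_le_norm u i : `|u 0 i| <= `|u|.
Proof.
rewrite [leRHS]/Num.norm /= mx_normrE.
exact: (le_bigmax _ (fun k : 'I_1 * 'I_n => `|u k.1 k.2|) (0, i)).
Qed.

(** Cauchy-Schwarz, from the nonnegativity of the squared norm of [|v|^2 u - <u, v> v]. *)
Lemma dot_le u v : dot u v <= enorm u * enorm v.
Proof.
have [v0|v0] := eqVneq (enorm v) 0.
  rewrite v0 mulr0 /dot big1 // => i _; suff -> : v 0 i = 0 by rewrite mulr0.
  by apply/eqP; rewrite -normr_le0 -v0 coord_le_enorm.
have vp : 0 < enorm v by rewrite lt_def v0 enorm_ge0.
have := dot_ge0 (enorm v ^+ 2 *: u - dot u v *: v).
rewrite !dotE (dotC v u) -!sqr_enorm.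
rewrite [X in 0 <= X](_ : _ =
  enorm v ^+ 2 * ((enorm u * enorm v) ^+ 2 - dot u v ^+ 2)); last by ring.
rewrite pmulr_rge0 ?exprn_gt0 // subr_ge0 => h.
apply: le_trans (ler_norm _) _.
by rewrite -(@ler_pXn2r _ 2) ?nnegrE ?mulr_ge0 ?enorm_ge0 // real_normK ?num_real.
Qed.

Lemma enormD u v : enorm (u + v) <= enorm u + enorm v.
Proof.
rewrite -(@ler_pXn2r _ 2) ?nnegrE ?addr_ge0 ?enorm_ge0 //.
rewrite sqrrD !sqr_enorm !dotE (dotC v u).
by have := dot_le u v; lra.
Qed.

Lemma enorm_sum (I : finType) (f : I -> 'rV[R]_n) :
  enorm (\sum_i f i) <= \sum_i enorm (f i).
Proof.
elim/big_ind2 : _ => [|x1 x2 y1 y2 h1 h2|//].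
  by rewrite -(scale0r 0) enormZ normr0 mul0r.
by apply: le_trans (enormD _ _) _; exact: lerD.
Qed.

(** With [norm_le_enorm], this lets Euclidean estimates be exchanged with the sup norm that carries
    the topology. The crude factor [n] comes from the triangle inequality over the coordinates. *)
Lemma enorm_le_norm u : enorm u <= n%:R * `|u|.
Proof.
rewrite {1}(row_sum_delta u); apply: le_trans (enorm_sum _ _) _.
apply: (@le_trans _ _ (\sum_(i < n) `|u|)); last by rewrite sumr_const card_ord mulr_natl.
apply: ler_sum => i _.
rewrite enormZ -[leRHS]mulr1; apply: ler_pM; rewrite ?enorm_ge0 ?coord_le_norm //.
rewrite /enorm (_ : dot _ _ = 1) ?sqrtr1 //.
rewrite /dot (bigD1 i) //= !mxE !eqxx mulr1 big1 ?addr0 // => j ji.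
by rewrite !mxE (negbTE ji) andbF mulr0.
Qed.

(** First-order optimality condition: along the segment the squared norm is
    [|u|^2 + s (2 <u, v> + s |v|^2)], which drops below [|u|^2] for small [s] if [<u, v> < 0]. *)
Lemma dot_ge0_of_min u v :
  (forall s, 0 <= s <= 1 -> dot u u <= dot (u + s *: v) (u + s *: v)) ->
  0 <= dot u v.
Proof.
move=> h; rewrite leNgt; apply/negP => uv0.
(* Chosen so that [0 < s <= 1] and [s |v|^2 <= - <u, v>], hence
   [2 <u, v> + s |v|^2 <= <u, v> < 0]. *)
pose s := - dot u v / (1 + dot v v - dot u v).
have vv := dot_ge0 v.
have d0 : 0 < 1 + dot v v - dot u v by lra.
have s0 : 0 < s by rewrite divr_gt0 // oppr_gt0.
have s1 : s <= 1 by rewrite ler_pdivrMr //; lra.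
have := h s; rewrite s1 ltW // => /(_ isT); rewrite !dotE (dotC v u).
have -> : dot u u + s * dot u v + (s * dot u v + s * (s * dot v v)) =
          dot u u + s * (2 * dot u v + s * dot v v) by ring.
rewrite lerDl pmulr_rge0 //.
have : s * dot v v <= - dot u v.
  by rewrite /s mulrAC ler_pdivrMr // ler_pM2l ?oppr_gt0 //; lra.
by lra.
Qed.

End euclidean.

(** * The point of least norm of a convex hull *)

Section min_norm.
Context {R : realType} {m n : nat}.
Implicit Types (G H : 'I_m -> 'rV[R]_n) (w : 'rV[R]_m).

Lemma compact_simplex : compact (@simplex R m).
Proof.
apply: bounded_closed_compact.
  exists 1; split => // r r1 w [w0 w1] /=; apply: le_trans (ltW r1).
  rewrite /Num.norm /= mx_normrE; apply: bigmax_le => // -[i j] _ /=.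
  by rewrite ord1 ger0_norm // -w1 (bigD1 j) //= lerDl sumr_ge0.
have -> : @simplex R m = (\bigcap_(i in [set: 'I_m]) [set w : 'rV[R]_m | 0 <= w 0 i]) `&`
    (fun w : 'rV[R]_m => \sum_i w 0 i) @^-1` [set 1].
  apply/seteqP; split=> w [w0 w1]; split => // i; [move=> _|]; exact: w0.
apply: closedI.
  apply: closed_bigI => i _.
  apply: (@preimage_closed _ _ (fun w : 'rV[R]_m => w 0 i) [set x | 0 <= x]).
    by move=> w ?; exact: coord_continuous.
  exact: closed_ge.
apply: preimage_closed; last exact: closed_eq.
by move=> w ?; apply: (continuous_big add_continuous) => i _; exact: coord_continuous.
Qed.

Lemma simplex_delta (i : 'I_m) : simplex (delta_mx 0 i : 'rV[R]_m).
Proof.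
split=> [j|]; first by rewrite mxE; case: (_ && _).
rewrite (bigD1 i) //= mxE !eqxx big1 ?addr0 // => j ji.
by rewrite mxE (negbTE ji) andbF.
Qed.

Lemma sum_delta G i : \sum_j (delta_mx 0 i : 'rV[R]_m) 0 j *: G j = G i.
Proof.
rewrite (bigD1 i) //= mxE !eqxx scale1r big1 ?addr0 // => j ji.
by rewrite mxE (negbTE ji) andbF scale0r.
Qed.

(** [pareto_gap] for an arbitrary family of vectors, so that the gradients at two points can be
    compared. *)
Definition gap G : R := inf [set enorm (\sum_i w 0 i *: G i) ^+ 2 | w in @simplex R m].

Lemma gap_min G : (0 < m)%N -> exists2 w, simplex w &
  gap G = enorm (\sum_i w 0 i *: G i) ^+ 2 /\
  forall w', simplex w' ->
    enorm (\sum_i w 0 i *: G i) ^+ 2 <= enorm (\sum_i w' 0 i *: G i) ^+ 2.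
Proof.
move=> m0; pose f (w : 'rV[R]_m) := enorm (\sum_i w 0 i *: G i) ^+ 2.
have cf : continuous f.
  rewrite (_ : f = fun w => dot (\sum_i w 0 i *: G i) (\sum_i w 0 i *: G i)); last first.
    by apply/funext => w; rewrite /f sqr_enorm.
  have ck k : continuous (fun w : 'rV[R]_m => (\sum_i w 0 i *: G i) 0 k).
    rewrite (_ : (fun _ => _) = fun w : 'rV[R]_m => \sum_i w 0 i * G i 0 k).
      apply: (continuous_big add_continuous) => i _ w.
      apply: (@continuousM _ _ (fun x : 'rV[R]_m => x 0 i) (fun=> G i 0 k)).
        exact: coord_continuous.
      exact: cst_continuous.
    by apply/funext => z; rewrite summxE; apply: eq_bigr => i _; rewrite mxE.
  apply: (continuous_big add_continuous) => k _ w.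
  exact: (continuousM (ck k w) (ck k w)).
have S0 : (@simplex R m) !=set0 by exists (delta_mx 0 (Ordinal m0)); exact: simplex_delta.
have [w /set_mem wS wmin] := EVT_min_rV S0 compact_simplex (continuous_subspaceT cf).
exists w => //; split; last by move=> w' w'S; apply: wmin; exact: mem_set.
apply/eqP; rewrite eq_le; apply/andP; split.
  apply: ge_inf; last by exists w.
  by exists 0 => _ [z _ <-]; rewrite sqr_ge0.
apply: lb_le_inf; first by exists (f w), w.
by move=> _ [z zS <-]; apply: wmin; exact: mem_set.
Qed.

Lemma gap_ge0 G : (0 < m)%N -> 0 <= gap G.
Proof. by move=> /(gap_min G)[w _ [-> _]]; exact: sqr_ge0. Qed.

(** The segment from the minimizer [u] to [G i] stays in the convex hull, so optimality gives
    [<u, G i - u> >= 0]. *)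
Lemma min_norm_point G : (0 < m)%N ->
  exists2 u, enorm u = Num.sqrt (gap G) & forall i, gap G <= dot (G i) u.
Proof.
move=> m0; have [w wS [-> wmin]] := gap_min G m0.
exists (\sum_i w 0 i *: G i); first by rewrite sqrtr_sqr ger0_norm ?enorm_ge0.
move=> i; set u := \sum_i _.
suff : 0 <= dot u (G i - u) by rewrite !dotE (dotC u) subr_ge0 sqr_enorm.
apply: dot_ge0_of_min => s /andP[s0 s1]; rewrite -!sqr_enorm.
have -> : u + s *: (G i - u) = \sum_j ((1 - s) *: w + s *: delta_mx 0 i) 0 j *: G j.
  rewrite (eq_bigr (fun j => (1 - s) *: (w 0 j *: G j) +
      s *: ((delta_mx 0 i : 'rV[R]_m) 0 j *: G j))).
    rewrite big_split /= -!scaler_sumr sum_delta scalerBr scalerBl scale1r -/u.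
    by rewrite [RHS]addrAC -addrA.
  by move=> j _; rewrite !scalerA -scalerDl; congr (_ *: _); rewrite !mxE.
apply: wmin; have [w0 w1] := wS; have [_ d1] := simplex_delta i; split.
  by move=> j; rewrite !mxE addr_ge0 ?mulr_ge0 ?subr_ge0 ?ler0n.
rewrite (eq_bigr (fun j => (1 - s) * w 0 j + s * (delta_mx 0 i : 'rV[R]_m) 0 j)).
  by rewrite big_split /= -!mulr_sumr w1 d1; lra.
by move=> j _; rewrite !mxE.
Qed.

(** The root of the gap is the distance from the origin to the convex hull. Testing [H] with the
    optimal weights of [G] shows that it is 1-Lipschitz in the family. *)
Lemma sqrt_gap_le G H d : (0 < m)%N -> (forall i, enorm (H i - G i) <= d) ->
  Num.sqrt (gap H) <= Num.sqrt (gap G) + d.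
Proof.
move=> m0 GH; have [w [w0 w1] [-> _]] := gap_min G m0.
rewrite [X in _ <= X + _]sqrtr_sqr ger0_norm ?enorm_ge0 //.
apply: (@le_trans _ _ (enorm (\sum_i w 0 i *: H i))).
  rewrite -[leRHS]ger0_norm ?enorm_ge0 // -sqrtr_sqr ler_sqrt ?sqr_ge0 //.
  apply: ge_inf; last by exists w.
  by exists 0 => _ [z _ <-]; rewrite sqr_ge0.
have -> : \sum_i w 0 i *: H i = \sum_i w 0 i *: G i + \sum_i w 0 i *: (H i - G i).
  by rewrite -big_split; apply: eq_bigr => i _; rewrite /= -scalerDr addrC subrK.
apply: le_trans (enormD _ _) _; rewrite lerD2l.
apply: le_trans (enorm_sum _ _) _.
rewrite -[leRHS]mul1r -w1 mulr_suml; apply: ler_sum => i _.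
by rewrite enormZ ger0_norm // ler_wpM2l.
Qed.

End min_norm.

(** * Monotonicity from an almost everywhere derivative *)

(** Supremum argument. The step jumps across [x], from [p] on its left to [q] on its right, so it
    applies at the supremum before [P] is known there. *)
Lemma real_induction {R : realType} (a b : R) (P : R -> Prop) :
  a <= b -> P a ->
  (forall x, a <= x <= b -> exists2 eta, 0 < eta & forall p q,
     a <= p <= x -> x <= q <= b -> x - eta < p -> q < x + eta -> P p -> P q) ->
  P b.
Proof.
move=> ab Pa step; pose S := [set x | a <= x <= b /\ P x].
have Sa : S a by split => //; rewrite lexx.
have Sb : has_sup S by split; [exists a|exists b => x [/andP[]]].
have ax : a <= sup S by apply: ub_le_sup => //; exact: Sb.2.
have xb : sup S <= b by apply: ge_sup; [exists a|move=> x [/andP[]]].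
have [|eta eta0 H] := step (sup S); first by rewrite ax.
have [p [/andP[ap pb] Pp] xp] := sup_adherent eta0 Sb.
have px : p <= sup S by apply: ub_le_sup; [exact: Sb.2|split => //; rewrite ap].
(* Either [b] is within reach of the supremum, or [P] holds beyond it, a contradiction. *)
have [bx|xb'] := leP b (sup S + eta / 2).
  by apply: (H p b) => //; rewrite ?ap ?xb ?lexx //; lra.
suff : S (sup S + eta / 2) by move=> /(ub_le_sup Sb.2); lra.
have q1 : sup S <= sup S + eta / 2 <= b by apply/andP; split; lra.
split; first by apply/andP; split; lra.
by apply: (H p) => //; [rewrite ap|lra].
Qed.

Lemma negligible_open_cover {R : realType} (N : set R) (d : R) :
  measurable N -> lebesgue_measure N = 0%E -> 0 < d ->
  exists U : set R, [/\ open U, N `<=` U & (lebesgue_measure U < d%:E)%E].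
Proof.
move=> mN N0 d0.
have [|U [oU NU Ud]] := lebesgue_regularity_outer mN _ d0.
  by rewrite [X in (X < _)%E](_ : _ = 0%E).
exists U; split => //; apply: le_lt_trans Ud.
rewrite -{1}(setDUK NU); apply: le_trans (measureU2 _ _ _) _ => //.
  by apply: measurableD => //; exact: open_measurable.
by rewrite [X in (X + _)%E](_ : _ = 0%E) ?add0e.
Qed.

Section almost_everywhere_monotone.
Context {R : realType} {n : nat}.
Variables (theta : R -> 'rV[R]_n) (f : R -> R) (a b L K : R).
Hypotheses (ab : a <= b) (L0 : 0 <= L) (K0 : 0 <= K).
Hypothesis theta_ac : abs_continuous a b theta.
Hypothesis f_le : forall p q, a <= p -> p <= q -> q <= b ->
  f q - f p <= L * enorm (theta q - theta p) + K * (q - p).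

(* The points where the derivative is controlled contribute at most
   [e * (x - a)] to the growth of [f] on [a, x]; the others lie in an open set
   of small measure, and the pairs in [s] are the subintervals covering them. *)
Let growth_bound e (U : set R) x (s : seq (R * R)) :=
  [/\ all (fun i => [&& a <= i.1, i.1 <= i.2 & i.2 <= x]) s,
      pairwise (fun i j => (i.2 <= j.1) || (j.2 <= i.1)) s,
      ((\sum_(i <- s) (i.2 - i.1))%:E <= lebesgue_measure (U `&` `[a, x]))%E &
      f x - f a <= e * (x - a) + \sum_(i <- s) (f i.2 - f i.1)].

(** The growth from [x] to [y] is absorbed by the term [e * (y - x)]; the list of intervals is
    kept. *)
Lemma growth_bound_good e U x y s : 0 <= e -> open U -> x <= y ->
  f y - f x <= e * (y - x) -> growth_bound e U x s -> growth_bound e U y s.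
Proof.
move=> e0 oU xy fxy [sx sdisj sU fs]; split => //.
- apply: sub_all sx => i /and3P[-> -> ix] /=; exact: le_trans xy.
- apply: le_trans sU _; apply: le_measure; rewrite ?inE.
  + by apply: measurableI => //; exact: open_measurable.
  + by apply: measurableI => //; exact: open_measurable.
  + apply: setIS => z /=; rewrite !in_itv /= => /andP[-> zx] /=; exact: le_trans xy.
- by rewrite mulrBr in fxy fs *; lra.
Qed.

(** The growth from [x] to [y] is charged to a new interval of the list, whose length is paid for by
    the measure of [U]. *)
Lemma growth_bound_bad e U x y s : 0 <= e -> open U -> a <= x -> x <= y ->
  `]x, y] `<=` U -> growth_bound e U x s -> growth_bound e U y ((x, y) :: s).
Proof.
move=> e0 oU ax xy xyU [sx sdisj sU fs]; split => /=.
- rewrite ax xy lexx /=.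
  apply: sub_all sx => i /and3P[-> -> ix] /=; exact: le_trans xy.
- rewrite sdisj andbT; apply: sub_all sx => i /and3P[_ _ ix] /=.
  by rewrite ix orbT.
- rewrite big_cons /= EFinD.
  (* Being open at [x], the new interval is disjoint from [[a, x]], so the two measures add up. *)
  apply: (@le_trans _ _ (lebesgue_measure (`]x, y] `|` (U `&` `[a, x])))).
    rewrite measureU //.
    + apply: leeD => //.
      have : ((y - x)%:E <= @lebesgue_measure R `]x, y]%classic)%E.
        rewrite lebesgue_measure_itv /= lte_fin.
        by case: ltgtP xy => // -> _; rewrite subrr.
      exact.
    + by apply: measurableI => //; exact: open_measurable.
    + rewrite -subset0 => z [] /=; rewrite !in_itv /= => /andP[xz _] [_ /andP[_ zx]].
      by move: (lt_le_trans xz zx); rewrite ltxx.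
  apply: le_measure; rewrite ?inE.
  + apply: measurableU => //; apply: measurableI => //; exact: open_measurable.
  + by apply: measurableI => //; exact: open_measurable.
  + move=> z [zxy|[Uz]].
      split; first exact: xyU.
      move: zxy; rewrite /= !in_itv /= => /andP[xz ->]; rewrite andbT.
      by apply: le_trans ax _; exact: ltW.
    rewrite /= !in_itv /= => /andP[az zx]; split => //.
    by rewrite az /=; exact: le_trans xy.
- rewrite big_cons /=.
  have : e * (x - a) <= e * (y - a) by rewrite ler_wpM2l // lerD2r.
  by lra.
Qed.

(** The listed intervals have total length below both [d] and [e]. By absolute continuity [theta]
    varies by less than [e] over them, so [f] grows there by at most [(L + K) e]. *)
Lemma growth_bound_total e U s d : 0 < e ->
  (forall (N : nat) (p q : 'I_N -> R),
    (forall i, a <= p i /\ p i <= q i /\ q i <= b) ->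
    (forall i j, i != j -> q i <= p j \/ q j <= p i) ->
    \sum_(i < N) (q i - p i) < d ->
    \sum_(i < N) enorm (theta (q i) - theta (p i)) < e) ->
  (lebesgue_measure U < (Num.min d e)%:E)%E -> open U ->
  growth_bound e U b s -> f b - f a <= e * (b - a + L + K).
Proof.
move=> e0 hd Ud oU [sab sdisj sU fs].
have sumE (F : R * R -> R) :
    \sum_(i <- s) F i = \sum_(i < size s) F (nth (0, 0) s i).
  by rewrite (big_nth (0, 0)) big_mkord.
have len : \sum_(i <- s) (i.2 - i.1) < Num.min d e.
  rewrite -lte_fin; apply: le_lt_trans Ud; apply: le_trans sU _.
  apply: le_measure; rewrite ?inE.
  - by apply: measurableI => //; exact: open_measurable.
  - exact: open_measurable.
  - exact: subIsetl.
move: len; rewrite lt_min => /andP[lend lene].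
have sn (i : 'I_(size s)) : [&& a <= (nth (0, 0) s i).1,
    (nth (0, 0) s i).1 <= (nth (0, 0) s i).2 & (nth (0, 0) s i).2 <= b].
  by move/(all_nthP (0, 0)) : sab; exact.
have var : \sum_(i <- s) enorm (theta i.2 - theta i.1) < e.
  rewrite sumE; apply: hd => [i|i j ij|]; last by rewrite -(sumE (fun i => i.2 - i.1)).
    by have /and3P[] := sn i.
  move/(pairwiseP (0, 0)) : sdisj => sdisj; apply/orP.
  have [ij'|ji|eij] := ltngtP i j; last by move: ij; rewrite (val_inj eij) eqxx.
    by apply: sdisj => //; rewrite inE.
  by rewrite orbC; apply: sdisj => //; rewrite inE.
have : \sum_(i <- s) (f i.2 - f i.1) <=
    L * \sum_(i <- s) enorm (theta i.2 - theta i.1) + K * \sum_(i <- s) (i.2 - i.1).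
  rewrite !mulr_sumr -big_split !sumE; apply: ler_sum => i _.
  by have /and3P[? ? ?] := sn i; exact: f_le.
have : L * \sum_(i <- s) enorm (theta i.2 - theta i.1) <= L * e.
  by rewrite ler_wpM2l // ltW.
have : K * \sum_(i <- s) (i.2 - i.1) <= K * e by rewrite ler_wpM2l // ltW.
rewrite !mulrDr; lra.
Qed.

(** Real induction on the existence of a list satisfying [growth_bound]: points of the null set are
    crossed inside an open cover of small measure, the others by their slope estimate. Then [e]
    tends to 0. *)
Lemma ae_derive_le0_le :
  {ae lebesgue_measure, forall x : R, a <= x <= b -> forall e, 0 < e ->
    exists2 eta, 0 < eta & forall p q, a <= p <= x -> x <= q <= b ->
      x - eta < p -> q < x + eta -> f q - f p <= e * (q - p)} ->
  f b <= f a.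
Proof.
move=> [N [mN N0 badN]].
suff H e : 0 < e -> f b - f a <= e * (b - a + L + K).
  (* The added 1 makes the divisor positive even when [a = b] and both constants vanish. *)
  have M0 : 0 < b - a + L + K + 1 by move: ab L0 K0; lra.
  rewrite -subr_le0; apply/ler_addgt0Pr => e e0; rewrite add0r.
  have /le_trans -> // := H _ (divr_gt0 e0 M0).
  rewrite mulrAC ler_pdivrMr // ler_wpM2l ?(ltW e0) //; lra.
move=> e0; have [d d0 hd] := theta_ac e e0.
have [|U [oU NU Ud]] := @negligible_open_cover R N (Num.min d e) mN N0.
  by rewrite lt_min d0.
suff [s hs] : exists s, growth_bound e U b s.
  exact: (@growth_bound_total e U s d).
apply: (@real_induction R a b (fun x => exists s, growth_bound e U x s)) => //.
  by exists [::]; split; rewrite ?big_nil ?subrr ?mulr0 ?addr0 // measure_ge0.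
move=> x xab; have [Nx|Nx] := pselect (N x).
  have /nbhs_ballP[eta /= eta0 etaU] : nbhs x U.
    by apply: open_nbhs_nbhs; split => //; exact: NU.
  exists eta => // p q /andP[ap px] /andP[xq qb] xp qx [s hs]; exists ((p, q) :: s).
  apply: growth_bound_bad => //; [exact: ltW|exact: le_trans xq|].
  move=> z /=; rewrite in_itv /= => /andP[pz zq]; apply: etaU.
  by rewrite /ball /= ltr_norml; apply/andP; split; lra.
have /(_ _ e e0)[//|eta eta0 H] : a <= x <= b -> forall e, 0 < e ->
    exists2 eta, 0 < eta & forall p q, a <= p <= x -> x <= q <= b ->
      x - eta < p -> q < x + eta -> f q - f p <= e * (q - p).
  by apply: contrapT => h; apply: Nx; exact: badN.
exists eta => // p q hp hq xp qx [s hs]; exists s.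
apply: growth_bound_good hs => //; [exact: ltW| |exact: H].
by move: hp hq => /andP[_ px] /andP[xq _]; exact: le_trans px xq.
Qed.

End almost_everywhere_monotone.

(** * Gradients and velocities *)

Section gradient.
Context {R : realType} {n : nat}.
Implicit Types (f : 'rV[R]_n -> R) (theta : R -> 'rV[R]_n).

Lemma dot_grad f x v : differentiable f x -> dot (grad f x) v = 'D_v f x.
Proof.
move=> df; rewrite deriveE // {2}(row_sum_delta v) linear_sum /=.
by apply: eq_bigr => i _; rewrite linearZ /= mxE deriveE // mulrC.
Qed.

Lemma normr_dot_le (u v : 'rV[R]_n) : `|dot u v| <= enorm u * enorm v.
Proof.
rewrite ler_norml dot_le andbT lerNl -dotNl.
by apply: le_trans (dot_le _ _) _; rewrite enormN.
Qed.

Lemma differentiable_grad_le f x e : differentiable f x -> 0 < e ->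
  exists2 eta, 0 < eta & forall h, `|h| < eta ->
    `|f (h + x) - f x - dot (grad f x) h| <= e * `|h|.
Proof.
move=> df e0; have := diff_locally df; move/eqaddoP => /(_ e e0) /nbhs_ballP.
move=> [eta /= eta0 H]; exists eta => // h heta.
have := H h; rewrite -ball_normE /= sub0r normrN => /(_ heta).
rewrite !fctE /= opprD addrA /cst.
by rewrite dot_grad // deriveE.
Qed.

Lemma is_derive_nneg_le theta s d e : is_derive_nneg theta s d -> 0 < e ->
  exists2 eta, 0 < eta & forall y, 0 <= y -> `|y - s| < eta ->
    `|theta y - theta s - (y - s) *: d| <= e * `|y - s|.
Proof.
move=> /cvgrPdist_lt H e0; have /nbhs_ballP[eta /= eta0 He] := H e e0.
exists eta => // y y0 ys; have [->|yns] := eqVneq y s.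
  by rewrite !subrr scale0r subr0 !normr0 mulr0.
have h0 : y - s != 0 by rewrite subr_eq0.
have := He (y - s); rewrite /ball /= sub0r normrN => /(_ ys h0).
rewrite addrC subrK => /(_ y0) /ltW; rewrite distrC => hy.
have -> : theta y - theta s - (y - s) *: d =
    (y - s) *: ((y - s)^-1 *: (theta y - theta s) - d).
  by rewrite scalerBr scalerA divff // scale1r.
by rewrite normrZ mulrC ler_wpM2r.
Qed.

(** The error splits into the remainder of [f] at the increment of [theta] and the gradient applied
    to the remainder of [theta]. Only times [y >= 0] enter, which covers [s = 0]. *)
Lemma chain_rule_nneg f theta s d e : differentiable f (theta s) ->
  is_derive_nneg theta s d -> 0 < e ->
  exists2 eta, 0 < eta & forall y, 0 <= y -> `|y - s| < eta ->
    `|f (theta y) - f (theta s) - (y - s) * dot (grad f (theta s)) d|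
      <= e * `|y - s|.
Proof.
move=> df dtheta e0.
have d1 : 0 < `|d| + 1 by rewrite ltr_wpDl.
(* Each of the two errors gets [e / 2]; the increment of [theta] will be at most
   [(|d| + 1) |y - s|]. *)
have e1 : 0 < e / 2 / (`|d| + 1) by rewrite !divr_gt0.
have [eta1 eta10 H1] := differentiable_grad_le _ _ _ df e1.
pose L := enorm (grad f (theta s)) * n%:R.
have L0 : 0 <= L by rewrite mulr_ge0 ?enorm_ge0.
have L1 : 0 < 1 + L by rewrite ltr_wpDr.
(* The bound 1 controls the increment of [theta]; the other bound compensates the factor [L] of the
   gradient. *)
pose e2 := Num.min 1 (e / 2 / (1 + L)).
have e20 : 0 < e2 by rewrite lt_min ltr01 !divr_gt0.
have [eta2 eta20 H2] := is_derive_nneg_le _ _ _ _ dtheta e20.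
exists (Num.min eta2 (eta1 / (`|d| + 1))).
  by rewrite lt_min eta20 divr_gt0.
move=> y y0; rewrite lt_min => /andP[ys2 ys1].
have r := H2 y y0 ys2; set dy := theta y - theta s in r *.
have dyd : `|dy| <= `|y - s| * (`|d| + 1).
  have -> : dy = (dy - (y - s) *: d) + (y - s) *: d by rewrite subrK.
  apply: le_trans (ler_normD _ _) _; rewrite normrZ mulrDr addrC lerD2l mulr1.
  by apply: le_trans r _; rewrite ler_piMl // ge_min lexx.
have dy1 : `|dy| < eta1 by apply: le_lt_trans dyd _; rewrite -ltr_pdivlMr.
have := H1 dy dy1; rewrite subrK => h1.
have -> : f (theta y) - f (theta s) - (y - s) * dot (grad f (theta s)) d =
  (f (theta y) - f (theta s) - dot (grad f (theta s)) dy) +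
  dot (grad f (theta s)) (dy - (y - s) *: d) by rewrite !dotE; ring.
apply: le_trans (ler_normD _ _) _.
have -> : e * `|y - s| = e / 2 * `|y - s| + e / 2 * `|y - s| by field.
apply: lerD.
  apply: le_trans h1 _; rewrite -[leLHS]mulrA ler_pM2l ?divr_gt0 //.
  by rewrite mulrC ler_pdivrMr.
apply: le_trans (normr_dot_le _ _) _.
apply: (@le_trans _ _ (L * `|dy - (y - s) *: d|)).
  by rewrite /L -mulrA ler_wpM2l ?enorm_ge0 ?enorm_le_norm.
apply: (@le_trans _ _ (L * (e2 * `|y - s|))); first by rewrite ler_wpM2l.
rewrite mulrA ler_wpM2r //.
apply: (@le_trans _ _ ((1 + L) * e2)); first by rewrite ler_wpM2r ?(ltW e20) // lerDr.
by rewrite mulrC -ler_pdivlMr // ge_min lexx orbT.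
Qed.

Lemma grad_mean_value f x v : (forall y, differentiable f y) ->
  exists2 t, 0 <= t <= 1 & f (x + v) - f x = dot (grad f (x + t *: v)) v.
Proof.
move=> df; pose g (t : R) := f (x + t *: v).
have gE t h : h^-1 *: (g (h *: 1 + t) - g t) =
    h^-1 *: (f (h *: v + (x + t *: v)) - f (x + t *: v)).
  rewrite /g; congr (_ *: (f _ - _)).
  by rewrite [h *: 1]mulr1 scalerDl addrCA.
have dg t : is_derive t (1 : R) g (dot (grad f (x + t *: v)) v).
  have dv : derivable f (x + t *: v) v by apply: diff_derivable.
  split; first by rewrite /derivable; under eq_fun do rewrite /= gE; exact: dv.
  rewrite dot_grad // /derive; apply: (congr1 (fun k : R -> R => lim (k h @[h --> 0^']))).
  by apply/funext => h /=; rewrite gE.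
have cg : {within `[0, 1], continuous g}.
  apply: derivable_within_continuous => t _; exact: ex_derive.
have [t t01 gt] := MVT_segment ler01 (fun t _ => dg t) cg.
exists t; first by rewrite in_itv in t01.
by move: gt; rewrite /g scale1r scale0r addr0 subr0 mulr1.
Qed.

(** The gradient is bounded only along the segment, so that local bounds on the gradients of the
    [ell i] can be used. *)
Lemma grad_lipschitz f x y L : (forall z, differentiable f z) ->
  (forall t, 0 <= t <= 1 -> enorm (grad f (x + t *: (y - x))) <= L) ->
  f y - f x <= L * enorm (y - x).
Proof.
move=> df fL; have [t t01] := grad_mean_value _ x (y - x) df.
rewrite subrKC => ->; apply: le_trans (dot_le _ _) _.
by rewrite ler_wpM2r ?enorm_ge0 // fL.
Qed.

Lemma near_enorm (P : 'rV[R]_n -> Prop) (x : 'rV[R]_n) : (\forall y \near x, P y) ->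
  exists2 eta, 0 < eta & forall y, enorm (y - x) < eta -> P y.
Proof.
move=> /nbhs_ballP[eta /= eta0 He]; exists eta => // y yx.
apply: He; rewrite -ball_normE /= distrC.
exact: le_lt_trans (norm_le_enorm _) yx.
Qed.

Lemma near_grad_enorm f (x : 'rV[R]_n) e : C1 f -> 0 < e ->
  \forall y \near x, enorm (grad f y - grad f x) <= e.
Proof.
move=> [_ /(_ x) /cvgrPdist_lt H] e0.
have n1 : 0 < n%:R + 1 :> R by rewrite ltr_wpDl.
apply: filterS (H _ (divr_gt0 e0 n1)) => y; rewrite distrC => h.
apply: le_trans (enorm_le_norm _) _.
apply: (@le_trans _ _ ((n%:R + 1) * `|grad f y - grad f x|)).
  by rewrite ler_wpM2r // lerDl.
by rewrite mulrC -ler_pdivlMr // ltW.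
Qed.

Lemma abs_continuous_continuous a b theta x e : abs_continuous a b theta ->
  a <= x <= b -> 0 < e ->
  exists2 eta, 0 < eta & forall y, a <= y <= b -> `|y - x| < eta ->
    enorm (theta y - theta x) < e.
Proof.
move=> ac /andP[ax xb] e0; have [eta eta0 H] := ac e e0.
exists eta => // y /andP[ay yb] yx.
(* A family of one interval, whose endpoints are put in order. *)
have := H 1 (fun=> Num.min x y) (fun=> Num.max x y).
rewrite !big_ord1 => h; apply: le_lt_trans (h _ _ _).
- by have [xy|yx'] := leP x y; rewrite // -opprB enormN.
- by move=> _; rewrite le_min ge_max ge_min le_max ax ay xb yb lexx.
- by move=> i j; rewrite !ord1 eqxx.
- move: yx; rewrite ltr_norml => /andP[]; clear h H.
  by have [xy|yx'] := leP x y; lra.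
Qed.

End gradient.

(** * Descent inequalities for the velocities of the flow *)

Section velocity.
Context {R : realType} {m n : nat}.
Variables (F : 'rV[R]_n -> R) (ell : 'I_m -> 'rV[R]_n -> R).
Hypothesis m_gt0 : (0 < m)%N.

Let pareto_gapE x : pareto_gap ell x = gap (fun i => grad (ell i) x) := erefl.

Lemma pareto_gap_ge0 x : 0 <= pareto_gap ell x.
Proof. exact: gap_ge0. Qed.

Lemma sqrt_pareto_gap_le x y d :
  (forall i, enorm (grad (ell i) y - grad (ell i) x) <= d) ->
  Num.sqrt (pareto_gap ell y) <= Num.sqrt (pareto_gap ell x) + d.
Proof. exact: sqrt_gap_le. Qed.

(* [v] is the projection of [grad F x] onto the feasible polyhedron, which
   contains [a *: u] for [u] the point of least norm of the convex hull of the
   gradients: the variational inequality of the projection, tested at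
   [a *: u], replaces the estimation of the Lagrange multipliers. *)
Lemma qp_argmin_dot_le c a x v : 0 <= a -> enorm (grad F x) <= c ->
  qp_argmin F ell x (a * pareto_gap ell x)%:E v ->
  dot (v - grad F x) v <=
    a * (a * pareto_gap ell x + c * Num.sqrt (pareto_gap ell x)).
Proof.
move=> a0 Fc [vfeas vmin].
have [u un uG] := min_norm_point (fun i => grad (ell i) x) m_gt0.
rewrite -pareto_gapE in un uG.
(* The polyhedron is convex and contains both [v] and [a *: u]. *)
have feas s : 0 <= s <= 1 ->
    qp_feasible ell x (a * pareto_gap ell x)%:E (v + s *: (a *: u - v)).
  move=> /andP[s0 s1] i; have := vfeas i; rewrite !lee_fin => vi.
  have ui : a * pareto_gap ell x <= a * dot (grad (ell i) x) u by rewrite ler_wpM2l.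
  rewrite !dotE.
  have : (1 - s) * (a * pareto_gap ell x) <= (1 - s) * dot (grad (ell i) x) v.
    by rewrite ler_wpM2l // subr_ge0.
  have : s * (a * pareto_gap ell x) <= s * (a * dot (grad (ell i) x) u).
    by rewrite ler_wpM2l.
  by lra.
have min s : 0 <= s <= 1 -> enorm (grad F x - v) <= enorm (grad F x - (v + s *: (a *: u - v))).
  move=> /feas /vmin; rewrite ler_pM2l ?invr_gt0 // ler_pXn2r // nnegrE ?enorm_ge0 //.
have : 0 <= dot (v - grad F x) (a *: u - v).
  apply: dot_ge0_of_min => s s01; rewrite -!sqr_enorm ler_pXn2r ?nnegrE ?enorm_ge0 //.
  by have := min s s01; rewrite -enormN opprB -[leRHS]enormN opprB addrAC.
(* It remains to bound [<v - grad F, a u>], by Cauchy-Schwarz with [|a u| = a sqrt g]. *)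
rewrite dotDr dotNr subr_ge0 => /le_trans; apply.
apply: le_trans (dot_le _ _) _; rewrite enormZ (ger0_norm a0) un.
set g := pareto_gap ell x; have g0 : 0 <= g := pareto_gap_ge0 x.
have -> : a * (a * g + c * Num.sqrt g) = (c + a * Num.sqrt g) * (a * Num.sqrt g).
  by rewrite -{1}(sqr_sqrtr g0); ring.
rewrite ler_wpM2r ?mulr_ge0 ?sqrtr_ge0 //.
(* At [s = 1] the competitor is [a *: u] itself, whence [|v - grad F| <= c + a sqrt g]. *)
rewrite -enormN opprB; have := min 1; rewrite ler01 lexx => /(_ isT) /le_trans; apply.
rewrite scale1r subrKC; apply: le_trans (enormD _ _) _.
by rewrite enormN enormZ (ger0_norm a0) un lerD2r.
Qed.

(** In all three regimes [- d] is a convex combination [z] of [grad F] and some [w] with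
    [<w - grad F, w> <= B], and the claim is [<z - grad F, z> <= B]. *)
Lemma filippov_velocity_descent c e a x d : 0 <= a -> enorm (grad F x) <= c ->
  filippov_velocity F ell e a x d ->
  dot (grad F x) d <= - enorm d ^+ 2 +
    a * (a * pareto_gap ell x + c * Num.sqrt (pareto_gap ell x)).
Proof.
move=> a0 Fc [dout din dbd].
set B := a * (_ + _).
have B0 : 0 <= B.
  by rewrite !(mulr_ge0, addr_ge0) ?pareto_gap_ge0 ?sqrtr_ge0 // (le_trans _ Fc) ?enorm_ge0.
suff [beta [w [/andP[b0 b1] wB ->]]] : exists beta w, [/\ 0 <= beta <= 1,
    dot (w - grad F x) w <= B & d = - (beta *: w + (1 - beta) *: grad F x)].
  rewrite enormN sqr_enorm !dotE.
  move: wB; rewrite !dotE (dotC (grad F x) w) => wB.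
  have := dot_ge0 (w - grad F x); rewrite !dotE (dotC (grad F x) w).
  set ww := dot w w in wB *; set wf := dot w _ in wB *; set ff := dot _ _ => nn.
  have h1 : beta * (ww - wf) <= beta * B by rewrite ler_wpM2l.
  have h2 : beta * B <= B by rewrite ler_piMl.
  (* Here [<z - grad F, z> = beta <w - grad F, w> - beta (1 - beta) |w - grad F|^2]. *)
  have h3 : 0 <= beta * (1 - beta) * (ww - wf + (- wf - - ff)).
    by rewrite !mulr_ge0 ?subr_ge0 //; move: nn; clear; lra.
  rewrite -subr_ge0; apply: le_trans (_ : 0 <= (B - beta * (ww - wf)) +
     beta * (1 - beta) * (ww - wf + (- wf - - ff))) _; first by lra.
  by rewrite le_eqVlt; apply/orP; left; apply/eqP; ring.
have [gin|gout] := pselect (pareto_set ell e x); last first.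
  have [v + ->] := dout gout; rewrite /nav_phi.
  case: ifPn => [/gout//|_ /qp_argmin_dot_le vB].
  exists 1, v; split; [by rewrite ler01 lexx|exact: vB|].
  by rewrite subrr scale0r scale1r addr0.
have [xint|xint] := pselect (interior (pareto_set ell e) x).
  exists 0, (grad F x); split; [by rewrite lexx ler01| |].
    by rewrite subrr -(scale0r 0) dotZl mul0r.
  by rewrite scale0r add0r subr0 scale1r din.
have [|beta [w [b01 /qp_argmin_dot_le wB dE]]] := dbd.
  by split => //; exact: subset_closure.
by exists beta, w; split => //; exact: wB.
Qed.

Lemma filippov_velocity_ell_le0 e a x d i : 0 <= a -> e < pareto_gap ell x ->
  filippov_velocity F ell e a x d -> dot (grad (ell i) x) d <= 0.
Proof.
move=> a0 ge [dout _ _]; have [|v [vfeas _] ->] := dout.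
  by apply/negP; rewrite -ltNge.
rewrite dotNr oppr_le0; have := vfeas i.
rewrite /nav_phi ifF; last by apply/negbTE; rewrite -ltNge.
rewrite lee_fin.
by apply: le_trans; rewrite mulr_ge0 ?pareto_gap_ge0.
Qed.

End velocity.

(** * Invariance of the Pareto closure *)

(** Adding the estimates on both sides of [s] gives the error [e ((q - s) + (s - p))]. This is the
    slope condition required by [ae_derive_le0_le]. *)
Lemma derive_le0_straddle {R : realType} (f : R -> R) s D e :
  (forall e, 0 < e -> exists2 eta, 0 < eta & forall y, 0 <= y -> `|y - s| < eta ->
    `|f y - f s - (y - s) * D| <= e * `|y - s|) ->
  D <= 0 -> 0 < e ->
  exists2 eta, 0 < eta & forall p q, 0 <= p <= s -> s <= q ->
    s - eta < p -> q < s + eta -> f q - f p <= e * (q - p).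
Proof.
move=> fD D0 e0; have [eta eta0 H] := fD e e0.
exists eta => // p q /andP[p0 ps] sq sp qs.
have q0 : 0 <= q by rewrite (le_trans p0) // (le_trans ps).
have := H p p0; have := H q q0.
rewrite (ger0_norm (_ : 0 <= q - s)) ?subr_ge0 //.
rewrite (ler0_norm (_ : p - s <= 0)) ?subr_le0 //.
move=> hq hp.
have {}hq : f q - f s - (q - s) * D <= e * (q - s).
  by apply: le_trans (ler_norm _) (hq _); lra.
have {}hp : - (f p - f s - (p - s) * D) <= e * - (p - s).
  by rewrite -normrN in hp; apply: le_trans (ler_norm _) (hp _); lra.
have : (q - p) * D <= 0 by rewrite mulr_ge0_le0 // subr_ge0 (le_trans ps).
rewrite !mulrBl in hq hp *; rewrite !mulrBr in hq hp *; lra.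
Qed.

Lemma lt_sub_half {R : realFieldType} {x y : R} : y < x -> y < x - (x - y) / 2.
Proof. by lra. Qed.

Section flow.
Context {R : realType} {m n : nat}.
Variables (F : 'rV[R]_n -> R) (ell : 'I_m -> 'rV[R]_n -> R).
Variables (e : R) (alpha : R -> R) (theta : R -> 'rV[R]_n).
Hypotheses (m_gt0 : (0 < m)%N) (ellC1 : forall i, C1 (ell i)).
Hypothesis alpha_ge0 : forall t : R, 0 <= t -> 0 <= alpha t.
Hypothesis flow : pareto_navigation_flow F ell e alpha theta.

Lemma near_sqrt_pareto_gap (x : 'rV[R]_n) d : 0 < d ->
  \forall y \near x,
    Num.sqrt (pareto_gap ell y) <= Num.sqrt (pareto_gap ell x) + d /\
    Num.sqrt (pareto_gap ell x) <= Num.sqrt (pareto_gap ell y) + d.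
Proof.
move=> d0.
have : \forall y \near x, forall i, enorm (grad (ell i) y - grad (ell i) x) <= d.
  have H i : \forall y \near x, enorm (grad (ell i) y - grad (ell i) x) <= d.
    exact: near_grad_enorm.
  exact: filter_forall H.
apply: filterS => y yx; split; first exact: sqrt_pareto_gap_le.
by apply: (sqrt_pareto_gap_le _ m_gt0) => i; rewrite -enormN opprB; exact: yx.
Qed.

Lemma near_pareto_gap_gt (x : 'rV[R]_n) : 0 <= e -> e < pareto_gap ell x ->
  \forall y \near x, e < pareto_gap ell y.
Proof.
move=> e0 ex.
have sqrt_lt : Num.sqrt e < Num.sqrt (pareto_gap ell x).
  by rewrite ltr_sqrt // (le_lt_trans e0).
pose d := (Num.sqrt (pareto_gap ell x) - Num.sqrt e) / 2.
have d0 : 0 < d by rewrite divr_gt0 // subr_gt0.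
apply: filterS (near_sqrt_pareto_gap x _ d0) => y [_].
rewrite -lerBlDr => yx; rewrite ltNge; apply/negP => ye.
have := le_trans yx (ler_wsqrtr ye).
by rewrite leNgt (lt_sub_half sqrt_lt).
Qed.

(** The strict inequality [e < eps] puts the level set [e] in the interior of the level set
    [eps]. *)
Lemma near_pareto_gap_le (x : 'rV[R]_n) eps : e < eps -> 0 < e ->
  pareto_gap ell x <= e -> \forall y \near x, pareto_gap ell y <= eps.
Proof.
move=> ee e0 xe; have eps0 : 0 < eps := lt_trans e0 ee.
have d0 : 0 < Num.sqrt eps - Num.sqrt e by rewrite subr_gt0 ltr_sqrt.
apply: filterS (near_sqrt_pareto_gap x _ d0) => y [yx _].
rewrite -ler_sqrt; last exact: ltW.
apply: le_trans yx _; rewrite addrCA gerDl subr_le0.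
exact: ler_wsqrtr.
Qed.

(** Where the gap exceeds [e], the constraints make the derivative of [ell i] along the flow
    nonpositive almost everywhere. The Lipschitz bound transfers absolute continuity from
    [theta]. *)
Lemma flow_ell_le i p q : 0 <= p -> p <= q ->
  (forall r, p <= r <= q -> e < pareto_gap ell (theta r)) ->
  (exists2 L, 0 <= L & forall r s, p <= r -> r <= s -> s <= q ->
    ell i (theta s) - ell i (theta r) <= L * enorm (theta s - theta r)) ->
  ell i (theta q) <= ell i (theta p).
Proof.
move=> p0 pq gapr [L L0 hL].
have [ac ae] := flow.
apply: (ae_derive_le0_le theta (fun r => ell i (theta r)) p q L 0) => //.
- exact: ac.
- by move=> r s pr rs sq; rewrite mul0r addr0 hL.
case: ae => N [mN N0 aeN]; exists N; split => //; apply: subset_trans aeN.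
apply: subsetC => s vel /andP[ps sq] eta eta0.
have s0 : 0 <= s := le_trans p0 ps.
have [d dtheta dF] := vel s0.
have [|||del del0 H] := derive_le0_straddle (fun r => ell i (theta r)) s
  (dot (grad (ell i) (theta s)) d) eta.
- by move=> ? ?; apply: chain_rule_nneg => //; exact: (ellC1 i).1.
- by apply: filippov_velocity_ell_le0 dF => //; [exact: alpha_ge0|apply: gapr; rewrite ps].
- exact: eta0.
exists del => // r t /andP[pr rs] /andP[st tq]; apply: H => //.
by rewrite rs (le_trans p0).
Qed.

Lemma flow_pareto_set_closure eps t : 0 < e -> e < eps ->
  pareto_set ell eps (theta 0) -> 0 <= t ->
  pareto_set_closure ell eps (theta t).
Proof.
move=> e0 ee th0 t0; have [ac _] := flow.
have closure_refl x : pareto_set ell eps x -> pareto_set_closure ell eps x.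
  by exists x.
apply: (@real_induction R 0 t (fun t => pareto_set_closure ell eps (theta t))) => //.
  exact: closure_refl.
(* If the gap at [theta x] is at most [e], then just after [x] the flow is in the level set [eps]
   itself, whatever happened before. *)
move=> x xt; have [gx|gx] := leP (pareto_gap ell (theta x)) e.
  have [r r0 hr] := near_enorm _ _ (near_pareto_gap_le _ _ ee e0 gx).
  have [eta eta0 heta] := abs_continuous_continuous _ _ _ _ _ (ac 0 t (lexx 0) t0) xt r0.
  exists eta => // p q _ /andP[xq qt] _ qx _; apply: closure_refl; apply: hr; apply: heta.
    by rewrite qt andbT; case/andP: xt => x0 _; exact: le_trans xq.
  by rewrite ger0_norm ?subr_ge0 // ltrBlDl.
(* Otherwise the gap exceeds [e] around [x], all the [ell i] decrease from [p] to [q], and the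
   witness at [p] still serves at [q]. *)
have near_good : \forall y \near theta x, e < pareto_gap ell y /\
    forall i, enorm (grad (ell i) y - grad (ell i) (theta x)) <= 1.
  apply: filterI; first by apply: near_pareto_gap_gt => //; exact: ltW.
  have H j : \forall y \near theta x, enorm (grad (ell j) y - grad (ell j) (theta x)) <= 1.
    exact: near_grad_enorm.
  exact: filter_forall H.
have [r r0 hr] := near_enorm _ _ near_good.
have [eta eta0 heta] := abs_continuous_continuous _ _ _ _ _ (ac 0 t (lexx 0) t0) xt r0.
exists eta => // p q /andP[p0 px] /andP[xq qt] xp qx [z zP zp]; exists z => // i.
have close s : p <= s <= q -> enorm (theta s - theta x) < r.
  move=> /andP[ps sq]; apply: heta; first by rewrite (le_trans p0) // (le_trans sq).
  by rewrite ltr_norml; apply/andP; split; clear hr; lra.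
apply: le_trans (zp i); apply: flow_ell_le p0 (le_trans px xq) _ _.
  by move=> s /close /hr[].
exists (enorm (grad (ell i) (theta x)) + 1); first by rewrite addr_ge0 ?enorm_ge0.
move=> s u ps su uq; apply: grad_lipschitz; first exact: (ellC1 i).1.
move=> w /andP[w0 w1].
(* The Euclidean ball is convex, so the gradient bound holds on the whole segment. *)
have su' : enorm (theta s + w *: (theta u - theta s) - theta x) < r.
  have -> : theta s + w *: (theta u - theta s) - theta x =
      (1 - w) *: (theta s - theta x) + w *: (theta u - theta x).
    by apply/rowP => j; rewrite !mxE; ring.
  apply: le_lt_trans (enormD _ _) _.
  rewrite !enormZ (ger0_norm w0) (ger0_norm (_ : 0 <= 1 - w)) ?subr_ge0 //.
  have cs := close s; have cu := close u.
  set A := enorm (theta s - _) in cs *; set B := enorm (theta u - _) in cu *.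
  have hA : A < r by apply: cs; rewrite ps (le_trans su).
  have hB : B < r by apply: cu; rewrite uq (le_trans ps).
  have M : Num.max A B < r by rewrite gt_max hA.
  apply: le_lt_trans M.
  have -> : Num.max A B = (1 - w) * Num.max A B + w * Num.max A B by ring.
  by apply: lerD; rewrite ler_wpM2l ?subr_ge0 // le_max lexx ?orbT.
have [_ /(_ i) h] := hr _ su'.
rewrite -[X in enorm X](subrK (grad (ell i) (theta x))).
by apply: le_trans (enormD _ _) _; rewrite addrC lerD2l.
Qed.

End flow.

(** * Rates *)

Section integral_comparison.
Context {R : realType}.
Local Notation mu := (@lebesgue_measure R).

Lemma derivable_slope (f : R -> R) s D e : derivable f s 1 -> (f^`())%classic s = D ->
  0 < e -> exists2 eta, 0 < eta & forall y, `|y - s| < eta ->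
    `|f y - f s - (y - s) * D| <= e * `|y - s|.
Proof.
rewrite derive1E => df <- /[dup] e0.
have /cvgrPdist_lt/[apply]/nbhs_ballP[eta /= eta0 H] := df.
exists eta => // y ys; have [->|yns] := eqVneq y s.
  by rewrite !subrr mul0r subr0 !normr0 mulr0.
have h0 : y - s != 0 by rewrite subr_eq0.
have := H (y - s); rewrite /ball /= sub0r normrN => /(_ ys h0).
rewrite [_ *: 1]mulr1 subrK => /ltW; rewrite distrC => hy.
have -> : f y - f s - (y - s) * 'D_1 f s =
    (y - s) * ((y - s)^-1 *: (f y - f s) - 'D_1 f s).
  by rewrite mulrBr mulrA divff // mul1r.
by rewrite normrM mulrC ler_wpM2r.
Qed.

Lemma integrable_patch_segment (D : R -> R) t :
  mu.-integrable `[0, t] (EFin \o D) ->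
  forall y, mu.-integrable `]-oo, y] (EFin \o (D \_ `[0, t])).
Proof.
move=> iD y; have -> : EFin \o (D \_ `[0, t]) = (EFin \o D) \_ `[0, t].
  by apply/funext => z /=; rewrite !patchE; case: ifP.
apply/integrable_restrict => //.
by apply: integrableS iD => //; exact: measurableI.
Qed.

Lemma ae_slope_Rintegral (D : R -> R) t :
  mu.-integrable `[0, t] (EFin \o D) ->
  {ae mu, forall x, 0 <= x <= t -> forall e, 0 < e ->
    exists2 eta, 0 < eta & forall y, `|y - x| < eta ->
      `|\int[mu]_(z in `]-oo, y]) (D \_ `[0, t]) z -
        \int[mu]_(z in `]-oo, x]) (D \_ `[0, t]) z - (y - x) * D x|
        <= e * `|y - x|}.
Proof.
move=> iD.
have iDr := integrable_patch_segment D t iD.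
have := FTC1Ny iDr (integrable_locally_restrict _ iD).
move=> /(_ (measurable_itv _)).
apply: negligibleS; apply: subsetC => x h /andP[x0 xt] e e0.
have [dI dIE] := h.
apply: (derivable_slope _ _ _ _ dI _ e0).
by rewrite dIE patchE mem_set //= in_itv /= x0.
Qed.

(** Let [I] be the primitive of the extension of [D] by 0. By Lebesgue differentiation [f - I] has a
    nonpositive derivative almost everywhere. Since [D >= 0], [I] is nondecreasing and [f - I]
    inherits the bound on the increments of [f]. *)
Lemma abs_continuous_le_Rintegral n (theta : R -> 'rV[R]_n) (f D : R -> R) t L K :
  0 <= t -> 0 <= L -> 0 <= K -> abs_continuous 0 t theta ->
  (forall p q, 0 <= p -> p <= q -> q <= t ->
    f q - f p <= L * enorm (theta q - theta p) + K * (q - p)) ->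
  mu.-integrable `[0, t] (EFin \o D) ->
  (forall x, 0 <= x <= t -> 0 <= D x) ->
  {ae mu, forall x, 0 <= x <= t -> exists2 d, d <= D x &
    forall e, 0 < e -> exists2 eta, 0 < eta & forall y, 0 <= y -> `|y - x| < eta ->
      `|f y - f x - (y - x) * d| <= e * `|y - x|} ->
  f t - f 0 <= \int[mu]_(x in `[0, t]) D x.
Proof.
move=> t0 L0 K0 ac fL iD D0 aef.
pose I y := \int[mu]_(z in `]-oo, y]) (D \_ `[0, t]) z.
have Dr0 z : 0 <= (D \_ `[0, t]) z.
  by rewrite patchE; case: ifPn => //; rewrite inE /= in_itv; exact: D0.
have iDr := integrable_patch_segment D t iD.
have I_mono p q : p <= q -> I p <= I q.
  move=> pq; apply: fine_le; [exact: integrable_fin_num|exact: integrable_fin_num|].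
  apply: ge0_subset_integral => //.
  - by have /integrableP[] := iDr q.
  - by move=> z _; rewrite lee_fin.
  - by apply: subset_itvl; rewrite bnd_simp.
have I0 : 0 <= I 0 by apply: Rintegral_ge0 => z _.
have It : I t = \int[mu]_(x in `[0, t]) D x.
  rewrite [LHS]Rintegral_mkcond [RHS]Rintegral_mkcond; apply: eq_Rintegral => z _.
  rewrite !patchE; case: ifPn => // zt; case: ifPn => // /set_mem /=.
  rewrite in_itv /= => /andP[_ zt']; move: zt; rewrite notin_setE /= in_itv /= zt' //.
suff ft : f t - I t <= f 0 - I 0.
  rewrite -It lerBlDr; apply: (@le_trans _ _ (I t + (f 0 - I 0))); first by rewrite -lerBlDl.
  by rewrite lerD2l gerDl oppr_le0.
apply: (ae_derive_le0_le theta (fun y => f y - I y) 0 t L K) => //.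
  move=> p q p0 pq qt; apply: le_trans (fL _ _ p0 pq qt).
  by have := I_mono _ _ pq; lra.
apply: negligibleS (negligibleU aef (ae_slope_Rintegral D t iD)).
move=> x /= nx; apply: contrapT => /not_orP[/contrapT fx /contrapT Ix]; apply: nx.
move=> xt e e0; have [d dD fd] := fx xt; have Id := Ix xt.
have [|||eta eta0 H] := derive_le0_straddle (fun y => f y - I y) x (d - D x) e.
- move=> r r0; have r2 : 0 < r / 2 by rewrite divr_gt0.
  have [eta1 e10 H1] := fd _ r2; have [eta2 e20 H2] := Id _ r2.
  exists (Num.min eta1 eta2); first by rewrite lt_min e10.
  move=> y y0; rewrite lt_min => /andP[y1 y2].
  have -> : f y - I y - (f x - I x) - (y - x) * (d - D x) =
    (f y - f x - (y - x) * d) - (I y - I x - (y - x) * D x) by ring.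
  apply: le_trans (ler_normB _ _) _.
  have -> : r * `|y - x| = r / 2 * `|y - x| + r / 2 * `|y - x| by field.
  by apply: lerD; [exact: H1|exact: H2].
- by rewrite subr_le0.
- exact: e0.
exists eta => // p q px /andP[xq _]; exact: H.
Qed.

End integral_comparison.

(** * Inequalities for real powers *)

Section powers.
Context {R : realType}.

(** If [x > l], write [x = l^(1 - g) x l^(g - 1)] and bound the last factor by [x^(g - 1)]. *)
Lemma le_add_powR (x l g : R) : 0 <= x -> 0 < l -> 1 <= g ->
  x <= l + l `^ (1 - g) * x `^ g.
Proof.
move=> x0 l0 g1; have [xl|lx] := leP x l.
  by apply: le_trans xl _; rewrite lerDl mulr_ge0 ?powR_ge0.
apply: (@le_trans _ _ (l `^ (1 - g) * x `^ g)); last by rewrite lerDr ltW.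
have xp : 0 < x := lt_trans l0 lx.
have xE : x `^ g = x * x `^ (g - 1).
  rewrite -{2}(powRr1 x0) -powRD ?(gt_eqF xp) ?implybT // addrC subrK //.
have lE : l `^ (1 - g) * (x * l `^ (g - 1)) = x.
  rewrite mulrCA -powRD; last by rewrite (gt_eqF l0) implybT.
  by rewrite addrA subrK subrr powRr0 mulr1.
rewrite xE -[leLHS]lE ler_wpM2l ?powR_ge0 // ler_wpM2l //.
by apply: ge0_ler_powR; rewrite ?nnegrE ?subr_ge0 // ltW.
Qed.

(** With [l = t^(-1/g)] this reads [l^(1 - g) = t l]: both terms of [le_add_powR], once integrated,
    are of order [t l]. *)
Lemma powR_rate (t g : R) : 0 < t -> 1 <= g ->
  (t `^ g^-1)^-1 `^ (1 - g) = t * (t `^ g^-1)^-1.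
Proof.
move=> t0 g1; have g0 : g != 0 by rewrite gt_eqF // (lt_le_trans ltr01).
have tn r : t `^ r * t = t `^ (r + 1).
  by rewrite -{2}(powRr1 (ltW t0)) -powRD // (gt_eqF t0) implybT.
rewrite [RHS]mulrC -powRN tn -powRrM; congr (_ `^ _).
by rewrite mulNr mulrBr mulr1 mulVf // opprB addrC.
Qed.

Lemma le_max_mulD (x y z w : R) : 0 <= y -> 0 <= w ->
  x * y + z * w <= Num.max x z * (y + w).
Proof.
move=> y0 w0; rewrite mulrDr; apply: lerD; apply: ler_wpM2r => //;
  by rewrite le_max lexx ?orbT.
Qed.

End powers.

(** * Integration along the flow *)

Section rate.
Context {R : realType} {m n : nat}.
Variables (F : 'rV[R]_n -> R) (ell : 'I_m -> 'rV[R]_n -> R).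
Variables (c e eps : R) (alpha : R -> R) (theta : R -> 'rV[R]_n).
Hypotheses (m_gt0 : (0 < m)%N) (F_C1 : C1 F) (ell_C1 : forall i, C1 (ell i)).
Hypotheses (F_lb : has_lbound (range F)) (gradF_le : forall x, enorm (grad F x) <= c).
Hypotheses (e_gt0 : 0 < e) (e_lt : e < eps).
Hypothesis alpha_meas : measurable_fun `[(0%R : R), +oo[ alpha.
Hypothesis alpha_ge0 : forall t : R, 0 <= t -> 0 <= alpha t.
Hypothesis alpha_ub : has_ubound (alpha @` `[(0%R : R), +oo[).
Hypothesis gap_ub : has_ubound (pareto_gap ell @` pareto_set_closure ell eps).
Hypothesis flow : pareto_navigation_flow F ell e alpha theta.
Hypothesis theta0 : pareto_set ell eps (theta 0).

Local Notation mu := (@lebesgue_measure R).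
Let Fstar := inf (range F).
Let geps := sup (pareto_gap ell @` pareto_set_closure ell eps).
Let rate s := alpha s * (alpha s * geps + c * Num.sqrt geps).
Let c_ge0 : 0 <= c := le_trans (enorm_ge0 _) (gradF_le 0).

Lemma gap_flow_le t : 0 <= t -> pareto_gap ell (theta t) <= geps.
Proof.
move=> t0; apply: (ub_le_sup gap_ub); exists (theta t) => //.
exact: (flow_pareto_set_closure F ell e alpha).
Qed.

Let geps_ge0 : 0 <= geps.
Proof.
exact: le_trans (pareto_gap_ge0 ell m_gt0 (theta 0)) (gap_flow_le 0 (lexx 0)).
Qed.

Lemma alpha_bound : exists2 A, 0 <= A & forall t, 0 <= t -> alpha t <= A.
Proof.
have [A Aub] := alpha_ub.
have AubE t : 0 <= t -> alpha t <= A.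
  by move=> t0; apply: Aub; exists t => //=; rewrite in_itv /= t0.
exists A; last exact: AubE.
exact: le_trans (alpha_ge0 0 (lexx 0)) (AubE 0 (lexx 0)).
Qed.

Lemma rate_ge0 s : 0 <= s -> 0 <= rate s.
Proof.
move=> s0; have a0 := alpha_ge0 s s0.
by rewrite mulr_ge0 // addr_ge0 // mulr_ge0 // sqrtr_ge0.
Qed.

(** Bounding one of the two factors [alpha] by [A] makes the rate linear in [alpha], with
    [sqrt geps] in front. *)
Lemma rate_le A s : 0 <= s -> alpha s <= A ->
  rate s <= Num.sqrt geps * (A * Num.sqrt geps + c) * alpha s.
Proof.
move=> s0 sA; have a0 := alpha_ge0 s s0; rewrite /rate.
rewrite mulrC ler_wpM2r // -{1}(sqr_sqrtr geps_ge0) expr2 mulrA -mulrDl mulrC.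
by rewrite ler_wpM2l ?sqrtr_ge0 // lerD2r ler_wpM2r ?sqrtr_ge0.
Qed.

Lemma alpha_measurable (t : R) : measurable_fun `[0, t] alpha.
Proof.
apply: measurable_funS alpha_meas => //.
by move=> x /=; rewrite !in_itv /= => /andP[-> _].
Qed.

Lemma rate_measurable (t : R) : measurable_fun `[0, t] rate.
Proof.
have ma := alpha_measurable t.
apply: measurable_funM => //; apply: measurable_funD.
  by apply: measurable_funM => //; exact: measurable_cst.
exact: measurable_cst.
Qed.

Lemma rate_integrable (t : R) : mu.-integrable `[0, t] (EFin \o rate).
Proof.
apply: measurable_bounded_integrable.
- exact: measurable_itv.
- rewrite /= lebesgue_measure_itv /=; case: ifP => // _.
  by rewrite -EFinB ltry.
- exact: rate_measurable.
have [A A0 Aub] := alpha_bound.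
exists (Num.sqrt geps * (A * Num.sqrt geps + c) * A); split; first exact: num_real.
move=> M AM x /=; rewrite in_itv /= => /andP[x0 _].
rewrite ger0_norm ?rate_ge0 //; apply: le_trans (ltW AM).
apply: le_trans (rate_le A x x0 (Aub x x0)) _.
rewrite ler_wpM2l ?Aub // !(mulr_ge0, addr_ge0) ?sqrtr_ge0 //.
Qed.

(** The function [F (theta y) + k y] has derivative at most [rate] almost everywhere on [[0, t]], as
    [k] is below every squared speed. A real [k] keeps the argument clear of infinite values. *)
Lemma inf_sq_speed_ge_mul k t : 0 < t -> (k%:E <= inf_sq_speed theta t)%E ->
  k * t <= F (theta 0) - Fstar + \int[mu]_(s in `[0, t]) rate s.
Proof.
move=> t0 kinf; have [ac vel] := flow.
have : F (theta t) + k * t - (F (theta 0) + k * 0) <= \int[mu]_(s in `[0, t]) rate s.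
  apply: (@abs_continuous_le_Rintegral R n theta (fun y => F (theta y) + k * y) rate t c `|k|).
  - exact: ltW.
  - exact: c_ge0.
  - exact: normr_ge0.
  - by apply: ac; rewrite ?lexx ?(ltW t0).
  - move=> p q p0 pq qt.
    have hF : F (theta q) - F (theta p) <= c * enorm (theta q - theta p).
      by apply: grad_lipschitz; [exact: F_C1.1|move=> *; exact: gradF_le].
    have hk : k * (q - p) <= `|k| * (q - p) by rewrite ler_wpM2r ?ler_norm // subr_ge0.
    have -> : F (theta q) + k * q - (F (theta p) + k * p) =
      (F (theta q) - F (theta p)) + k * (q - p) by ring.
    exact: lerD.
  - exact: rate_integrable.
  - by move=> x /andP[x0 _]; exact: rate_ge0.
  apply: negligibleS vel; apply: subsetC => s hs /andP[s0 st].
  have [d dtheta dF] := hs s0.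
  exists (dot (grad F (theta s)) d + k).
    have kd : k <= enorm d ^+ 2.
      rewrite -lee_fin; apply: le_trans kinf _; apply: ereal_inf_lbound.
      by exists s, d; rewrite s0 st.
    have := filippov_velocity_descent F ell m_gt0 c e (alpha s) (theta s) d
      (alpha_ge0 s s0) (gradF_le _) dF.
    have gs := gap_flow_le s s0.
    have : alpha s * (alpha s * pareto_gap ell (theta s) +
          c * Num.sqrt (pareto_gap ell (theta s)))
        <= rate s.
      rewrite /rate ler_wpM2l ?alpha_ge0 //; apply: lerD; apply: ler_wpM2l.
      - exact: alpha_ge0.
      - exact: gs.
      - exact: c_ge0.
      - exact: ler_wsqrtr.
    set B := alpha s * (_ + c * Num.sqrt (pareto_gap _ _)) => Br dB.
    rewrite -lerBrDr; apply: le_trans dB _; rewrite addrC.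
    by apply: lerD; rewrite // lerN2.
  move=> r r0; have [eta eta0 H] := chain_rule_nneg F theta s d r (F_C1.1 _) dtheta r0.
  exists eta => // y y0 ys; have := H y y0 ys.
  set G := dot _ _.
  have -> // : F (theta y) + k * y - (F (theta s) + k * s) - (y - s) * (G + k)
    = F (theta y) - F (theta s) - (y - s) * G by ring.
have : Fstar <= F (theta t) by apply: ge_inf => //; exists (theta t).
rewrite mulr0 addr0; set J := Rintegral _ _ _; set a := F (theta t); set b := F (theta 0).
move=> h1 h2.
have -> : k * t = (a + k * t - b) + (b - a) by ring.
rewrite addrC; apply: lerD => //; exact: lerB.
Qed.

Lemma inf_sq_speed_le t : 0 < t -> (inf_sq_speed theta t <=
  ((F (theta 0) - Fstar + \int[mu]_(s in `[0%R, t]) rate s) / t)%:E)%E.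
Proof.
move=> t0; set r := (_ / t).
have H k : (k%:E <= inf_sq_speed theta t)%E -> k <= r.
  by move=> /(inf_sq_speed_ge_mul k t t0); rewrite /r ler_pdivlMr.
case: (inf_sq_speed theta t) H => [k H|H|_]; last by rewrite leNye.
  by rewrite lee_fin; apply: H.
(* An infinite infimum would have the lower bound [r + 1], which exceeds [r]. *)
by have := H (r + 1) (leey _); rewrite gerDl ler10.
Qed.

Lemma rate_integralE t :
  (\int[mu]_(s in `[0%R, t]) (rate s)%:E = (\int[mu]_(s in `[0%R, t]) rate s)%:E)%E.
Proof.
by rewrite /Rintegral fineK //; apply: integrable_fin_num => //; exact: rate_integrable.
Qed.

Lemma rate_integral_cst a t : 0 < t -> (forall s, 0 <= s -> alpha s = a) ->
  \int[mu]_(s in `[0%R, t]) rate s = a * (a * geps + c * Num.sqrt geps) * t.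
Proof.
move=> t0 aE; rewrite (@eq_Rintegral _ _ _ _ _ (fun=> a * (a * geps + c * Num.sqrt geps))).
  rewrite Rintegral_cst //= lebesgue_measure_itv /= lte_fin t0.
  by rewrite oppr0 adde0.
by move=> s; rewrite inE /= in_itv /= => /andP[s0 _]; rewrite /rate aE.
Qed.

(** With [l = t^(-1/g)], [rate <= Q alpha <= Q l + Q l^(1 - g) alpha^g], whose integral over
    [[0, t]] is at most [Q t l (1 + J)]. *)
Lemma rate_integral_powR_le g : 1 <= g ->
  (\int[mu]_(t in `[(0%R : R), +oo[) (alpha t `^ g)%:E < +oo)%E ->
  exists2 M, 0 <= M & forall t, 0 < t ->
    \int[mu]_(s in `[0%R, t]) rate s <= M * (Num.sqrt geps / t `^ g^-1) * t.
Proof.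
move=> g1 intg; have [A A0 Aub] := alpha_bound.
set J := (\int[mu]_(t in _) _)%E in intg.
have J0 : (0 <= J)%E by apply: integral_ge0 => s _; rewrite lee_fin powR_ge0.
have Jfin : J \is a fin_num by rewrite ge0_fin_numE.
have JE : J = (fine J)%:E by rewrite fineK.
have fJ0 : 0 <= fine J by rewrite fine_ge0.
pose B := A * Num.sqrt geps + c.
have B0 : 0 <= B by rewrite addr_ge0 // mulr_ge0 ?sqrtr_ge0.
exists (B * (1 + fine J)); first by rewrite mulr_ge0 // addr_ge0.
move=> t t0.
pose l := (t `^ g^-1)^-1; have l0 : 0 < l by rewrite invr_gt0 powR_gt0.
pose Q := Num.sqrt geps * B; have Q0 : 0 <= Q by rewrite mulr_ge0 ?sqrtr_ge0.
have -> : B * (1 + fine J) * (Num.sqrt geps / t `^ g^-1) * t =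
    Q * l * t + Q * (t * l) * fine J by rewrite /Q /l; ring.
rewrite -lee_fin -rate_integralE -(powR_rate t g t0 g1) -/l EFinD.
have mpow (D : set R) : measurable D -> D `<=` `[0, +oo[ ->
    measurable_fun D (fun s => (alpha s `^ g)%:E).
  move=> mD D0; apply/measurable_EFinP.
  apply: (@measurableT_comp _ _ _ _ _ _ (@powR R ^~ g)) => //.
  exact: measurable_funS alpha_meas.
have sub : `[0, t] `<=` `[(0 : R), +oo[.
  by move=> x /=; rewrite !in_itv /= => /andP[-> _].
apply: (@le_trans _ _ (\int[mu]_(s in `[0%R, t])
    ((Q * l)%:E + (Q * l `^ (1 - g))%:E * (alpha s `^ g)%:E))%E).
  apply: ge0_le_integral => //.
  - by move=> s /=; rewrite in_itv /= => /andP[s0 _]; rewrite lee_fin rate_ge0.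
  - by apply/measurable_EFinP; exact: rate_measurable.
  - apply: emeasurable_funD; first exact: measurable_cst.
    apply: emeasurable_funM; first exact: measurable_cst.
    exact: mpow.
  move=> s /=; rewrite in_itv /= => /andP[s0 _].
  rewrite -EFinM -EFinD lee_fin; apply: le_trans (rate_le A s s0 (Aub s s0)) _.
  rewrite -/B -/Q [leRHS](_ : _ = Q * (l + l `^ (1 - g) * alpha s `^ g)).
    rewrite ler_wpM2l //; apply: le_add_powR => //; exact: alpha_ge0.
  by rewrite mulrDr mulrA.
have Ql0 : 0 <= Q * l by rewrite mulr_ge0 // ltW.
have Qp0 : 0 <= Q * l `^ (1 - g) by rewrite mulr_ge0 ?powR_ge0.
rewrite ge0_integralD //; last 2 first.
- by move=> s _; rewrite mule_ge0 // lee_fin // powR_ge0.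
- by apply: emeasurable_funM; [exact: measurable_cst|exact: mpow].
apply: leeD.
  rewrite [leLHS](integral_cst mu (measurable_itv `[0, t]) (Q * l)%:E).
  rewrite /= lebesgue_measure_itv /= lte_fin t0 oppr0 adde0 -EFinM //.
rewrite ge0_integralZl_EFin //; last 2 first.
- by move=> s _; rewrite lee_fin powR_ge0.
- exact: mpow.
rewrite [leRHS]EFinM; apply: lee_wpmul2l; first by rewrite lee_fin.
rewrite -JE.
apply: ge0_subset_integral => //; first exact: mpow.
by move=> s _; rewrite lee_fin powR_ge0.
Qed.

End rate.

Theorem theorem4 (R : realType) (m n : nat)
    (F : 'rV[R]_n -> R) (ell : 'I_m -> 'rV[R]_n -> R)
    (c e eps : R) (alpha : R -> R) (theta : R -> 'rV[R]_n)
    (hm : (0 < m)%N)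
    (hF : C1 F) (hell : forall i, C1 (ell i))
    (hFinf : has_lbound (range F))
    (hellinf : forall i, has_lbound (range (ell i)))
    (hc : forall x, enorm (grad F x) <= c)
    (he : 0 < e)
    (halpha_meas : measurable_fun `[(0%R : R), +oo[ alpha)
    (halpha_ge0 : forall t : R, 0 <= t -> 0 <= alpha t)
    (halpha_sup : has_ubound (alpha @` `[(0%R : R), +oo[))
    (heps : e < eps)
    (hg : has_ubound (pareto_gap ell @` pareto_set_closure ell eps))
    (hflow : pareto_navigation_flow F ell e alpha theta)
    (htheta0 : pareto_set ell eps (theta 0)) :
  let Fstar := inf (range F) in
  let geps := sup (pareto_gap ell @` pareto_set_closure ell eps) in
  [/\ forall t : R, 0 < t ->
        (inf_sq_speed theta t <=
         ((F (theta 0) - Fstar) / t)%:E +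
         (t^-1)%:E * \int[lebesgue_measure]_(s in `[(0%R : R), t])
           (alpha s * (alpha s * geps + c * Num.sqrt geps))%:E)%E,
      forall a : R, (forall t : R, 0 <= t -> alpha t = a) ->
        exists C : R, forall t : R, 0 < t ->
          (inf_sq_speed theta t <=
           (C * (t^-1 + a * Num.sqrt geps))%:E)%E
    & forall gamma : R, 1 <= gamma ->
        (\int[lebesgue_measure]_(t in `[(0%R : R), +oo[)
           (alpha t `^ gamma)%:E < +oo)%E ->
        exists C : R, forall t : R, 0 < t ->
          (inf_sq_speed theta t <=
           (C * (t^-1 + Num.sqrt geps / t `^ gamma^-1))%:E)%E].
Proof.
move=> Fstar geps.
pose rate s := alpha s * (alpha s * geps + c * Num.sqrt geps).
have Fstar_le : 0 <= F (theta 0) - Fstar.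
  by rewrite subr_ge0; apply: ge_inf => //; exists (theta 0).
have speed_le t : 0 < t -> (inf_sq_speed theta t <=
    ((F (theta 0) - Fstar + \int[lebesgue_measure]_(s in `[0%R, t]) rate s) / t)%:E)%E.
  move=> t0.
  exact: (inf_sq_speed_le F ell c e eps alpha theta hm hF hell hFinf hc he heps
    halpha_meas halpha_ge0 halpha_sup hg hflow htheta0 t t0).
have geps_ge0 : 0 <= geps.
  apply: le_trans (pareto_gap_ge0 ell hm (theta 0)) _; apply: (ub_le_sup hg).
  exists (theta 0) => //.
  exact: (flow_pareto_set_closure F ell e alpha theta hm hell halpha_ge0 hflow
    eps 0 he heps htheta0 (lexx 0)).
(* Common end of (a) and (b): the mean rate is at most [M w], and the larger of the two constants
   serves for both terms. *)
have big_O t M w : 0 < t -> 0 <= w ->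
    \int[lebesgue_measure]_(s in `[0%R, t]) rate s <= M * w * t ->
    (inf_sq_speed theta t <= (Num.max (F (theta 0) - Fstar) M * (t^-1 + w))%:E)%E.
  move=> t0 w0 rateM; apply: le_trans (speed_le t t0) _; rewrite lee_fin.
  rewrite mulrDl; apply: le_trans (le_max_mulD _ _ _ _ _ w0); last first.
    by rewrite invr_ge0 ltW.
  by rewrite lerD2l ler_pdivrMr.
split.
- move=> t t0; apply: le_trans (speed_le t t0) _.
  rewrite (rate_integralE F ell c e eps alpha theta hm hell hc he heps
    halpha_meas halpha_ge0 halpha_sup hg hflow htheta0 t).
  by rewrite -EFinM -EFinD lee_fin mulrDl [X in _ + X]mulrC.
(* The constant rate factors as [(a sqrt geps + c) (a sqrt geps)]. *)
- move=> a aE; exists (Num.max (F (theta 0) - Fstar) (a * Num.sqrt geps + c)) => t t0.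
  have a0 : 0 <= a by rewrite -(aE 0 (lexx 0)); exact: halpha_ge0.
  apply: big_O => //; first by rewrite mulr_ge0 ?sqrtr_ge0.
  rewrite (rate_integral_cst ell c eps alpha a t t0 aE) -/geps ler_wpM2r ?(ltW t0) //.
  by rewrite -{1}(sqr_sqrtr geps_ge0) le_eqVlt; apply/orP; left; apply/eqP; ring.
move=> g g1 gint.
have [M M0 hM] := rate_integral_powR_le F ell c e eps alpha theta hm hell hc he heps
    halpha_meas halpha_ge0 halpha_sup hg hflow htheta0 g g1 gint.
exists (Num.max (F (theta 0) - Fstar) M) => t t0; apply: big_O => //; last exact: hM.
by rewrite divr_ge0 ?sqrtr_ge0 ?powR_ge0.
Qed.
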